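(* The Borel transform $$\hat\omega(t,\xi)=\sum_{n=0}^\infty\frac{q_{n+1}(t)}{n!}\,\xi^n$$ of the formal solution $\hat q(t,\hbar)=\sum_{n\ge0}q_n(t)\hbar^n$ of the deformed Painlevé I equation is a convergent power series in $\xi$, locally uniformly for all nonzero $t$.
   Context: The deformed Painlevé I equation is $\hbar^2\partial_t^2q=6q^2+t$. Its formal solution $\hat q$ is the formal power series in $\hbar$ with holomorphic, possibly multivalued, coefficients on $\mathbb C_t^*=\mathbb C\smallsetminus\{0\}$ solving the equation order by order; it is determined by a choice of root $q_0$ of $6q_0^2+t=0$, with $q_{2n-1}=0$ and $q_{2n}=\frac1{12q_0}\big(\ddot q_{2n-2}-6\sum_{i+j=n,\ i,j\neq0}q_{2i}q_{2j}\big)$ for $n\ge1$. ''Convergent locally uniformly for all nonzero $t$'' means: every $t_0\in\mathbb C_t^*$ has a neighbourhood $U_0\subset\mathbb C_t^*$ and there is a neighbourhood $\Xi_0\subset\mathbb C_\xi$ of the origin such that any branch of $\hat\omega(t,\xi)$ over $U_0$ converges uniformly for $t\in U_0$ and defines a holomorphic function on $U_0\times\Xi_0$. *)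

(* Defs.v *)
From Stdlib Require Import Reals Factorial.
From Coquelicot Require Import Coquelicot.

Open Scope R_scope.
Open Scope C_scope.

Definition open_disc (c : C) (r : R) (z : C) : Prop := (Cmod (z - c) < r)%R.

Definition holomorphic_on (U : C -> Prop) (f : C -> C) : Prop :=
  forall z : C, U z -> ex_derive (K := C_AbsRing) (V := C_NormedModule) f z.

(* Holomorphy in two variables jointly: Frechet differentiability over C. *)
Definition holomorphic2_on (U V : C -> Prop) (f : C -> C -> C) : Prop :=
  forall x y : C, U x -> V y ->
    ex_filterdiff (K := C_AbsRing)
      (U := prod_NormedModule C_AbsRing (AbsRing_NormedModule C_AbsRing)
              (AbsRing_NormedModule C_AbsRing))
      (V := C_NormedModule)
      (fun p : C * C => f (fst p) (snd p)) (locally (x, y)).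

(* A formal power series  sum_n q_n(t) hbar^n  is the sequence
   q : nat -> C -> C of its coefficients. *)

(* Coefficients of hbar^n in  hbar^2 d_t^2 q  and in  6 q^2 + t.
   C_derive is a horizontal limit; it is the complex derivative wherever the
   latter exists, hence at every point of an open set where q m is holomorphic. *)
Definition PI_lhs_coeff (q : nat -> C -> C) (n : nat) (t : C) : C :=
  match n with
  | S (S m) => C_derive (C_derive (q m)) t
  | _ => 0
  end.

Definition PI_rhs_coeff (q : nat -> C -> C) (n : nat) (t : C) : C :=
  6 * sum_n (fun k : nat => q k t * q (n - k)%nat t) n
  + match n with O => t | S _ => 0 end.

(* Intended for a disc U avoiding 0: such a U is simply connected, so the
   single-valued branches over U of the multivalued formal solution on C^* are
   exactly the sequences below.  Both choices of the root q_0 are included,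
   since 6 q_0^2 + t = 0 is the order-0 equation. *)
Definition formal_solution_branch (U : C -> Prop) (q : nat -> C -> C) : Prop :=
  (forall n : nat, holomorphic_on U (q n)) /\
  (forall (n : nat) (t : C), U t -> PI_lhs_coeff q n t = PI_rhs_coeff q n t).

Definition borel_partial_sum (q : nat -> C -> C) (N : nat) (t xi : C) : C :=
  sum_n (fun n : nat => q (S n) t / RtoC (INR (fact n)) * xi ^ n) N.

Definition converges_uniformly_on (U : C -> Prop)
    (s : nat -> C -> C) (f : C -> C) : Prop :=
  forall eps : R, (0 < eps)%R ->
    exists N0 : nat, forall N : nat, (N0 <= N)%nat ->
      forall t : C, U t -> (Cmod (s N t - f t) < eps)%R.

(* Main.v *)
Require Import Defs.
From Stdlib Require Import Reals Lia Lra Arith Factorial.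
From Coquelicot Require Import Coquelicot.

(** Put u = q_0.  Since u^2 = -t/6, the function u behaves like t^(1/2) under
    differentiation, so f = u^(1-5m) satisfies f' = a f / t with
    a = (1 - 5m) / 2.  By induction the order-n equation then forces
    q_n = d_n u^(1-5n/2) with constants d_n that vanish for odd n, and the
    quadratic recursion for d_n gives |d_n| <= (n-1)! directly, because
    k! (m-k)! <= m!.  Summing over n = 2m + 1, the Borel transform is
    u^(-4) xi F(u^(-5) xi^2) for a power series F with coefficients bounded
    by 1; as |u|^2 = |t|/6, everything is uniform in t near t_0. *)

Local Open Scope R_scope.
Local Open Scope C_scope.

(** * Complex derivatives *)

Notation is_derive_C := (is_derive (K := C_AbsRing) (V := C_NormedModule)).

(* [C_NormedModule] and [AbsRing_NormedModule C_AbsRing] have the same norm but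
   different uniform structures; the product rules of Coquelicot concern the latter. *)
Lemma is_derive_C_AbsRing (f : C -> C) (z l : C) :
  is_derive_C f z l <->
  is_derive (K := C_AbsRing) (V := AbsRing_NormedModule C_AbsRing) f z l.
Proof.
  split; intros [[Hp Hs Hn] Hd]; (split; [split; assumption | exact Hd]).
Qed.

Lemma is_derive_C_mult (f g : C -> C) (z df dg : C) :
  is_derive_C f z df -> is_derive_C g z dg ->
  is_derive_C (fun w => f w * g w) z (df * g z + f z * dg).
Proof.
  rewrite !is_derive_C_AbsRing; intros Hf Hg.
  exact (is_derive_mult f g z df dg Hf Hg Cmult_comm).
Qed.

Lemma is_derive_C_scal (c : C) (f : C -> C) (z l : C) :
  is_derive_C f z l -> is_derive_C (fun w => c * f w) z (c * l).
Proof.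
  intros Hf; generalize (is_derive_C_mult _ _ _ _ _ (is_derive_const c z) Hf).
  change (@zero C_NormedModule) with (RtoC 0).
  now replace (RtoC 0 * f z + c * l) with (c * l) by ring.
Qed.

Lemma is_derive_C_id (z : C) : is_derive_C (fun w => w) z (RtoC 1).
Proof.
  apply is_derive_C_AbsRing; exact (is_derive_id (K := C_AbsRing) z).
Qed.

(** A quadratic remainder is o(|w - z|). This reduces the differentiability of [Cinv] and of power
    series to algebraic estimates. *)
Lemma is_derive_C_quadratic_remainder (f : C -> C) (z l : C) (delta M : R) :
  (0 < delta)%R ->
  (forall w, (Cmod (w - z) < delta)%R ->
     (Cmod (f w - f z - (w - z) * l) <= M * Cmod (w - z) ^ 2)%R) ->
  is_derive_C f z l.
Proof.
  intros Hdelta HM; split; [apply is_linear_scal_l|].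
  intros x Hx; apply (is_filter_lim_locally_unique
    (V := AbsRing_NormedModule C_AbsRing) z x) in Hx; subst x.
  intros [eps Heps]; simpl.
  (* [M] may be zero or negative; [Rabs M + 1] is a positive upper bound by which [eps] can be
     divided. *)
  assert (HK : (0 < Rabs M + 1)%R) by (pose proof (Rabs_pos M); lra).
  assert (Hd : (0 < Rmin delta (eps / (Rabs M + 1)))%R).
  { apply Rmin_glb_lt; [assumption|]. now apply Rdiv_lt_0_compat. }
  exists (mkposreal _ Hd); intros w Hw.
  change (Cmod (w - z) < Rmin delta (eps / (Rabs M + 1)))%R in Hw.
  change (Cmod (f w - f z - (w - z) * l) <= eps * Cmod (w - z))%R.
  assert (H1 := Rlt_le_trans _ _ _ Hw (Rmin_l _ _)).
  assert (H2 := Rlt_le_trans _ _ _ Hw (Rmin_r _ _)).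
  eapply Rle_trans; [now apply HM|].
  pose proof (Cmod_ge_0 (w - z)) as H0; pose proof (Rle_abs M).
  assert (H3 : ((Rabs M + 1) * Cmod (w - z) <= eps)%R).
  { left; apply (Rmult_lt_compat_l (Rabs M + 1)) in H2; [|assumption].
    now replace ((Rabs M + 1) * (eps / (Rabs M + 1)))%R with eps in H2 by (field; lra). }
  nra.
Qed.

(** The remainder equals (w - z)^2 / (w z^2), and |w| > |z| / 2 on the disc of radius |z| / 2 about
    z, whence the constant 2 / |z|^3. *)
Lemma is_derive_C_inv (z : C) : z <> 0 -> is_derive_C Cinv z (- / z ^ 2).
Proof.
  intros Hz; assert (Hz' := proj1 (Cmod_gt_0 z) Hz).
  apply (is_derive_C_quadratic_remainder _ _ _ (Cmod z / 2) (2 / Cmod z ^ 3)); [lra|].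
  intros w Hw.
  assert (Hw1 : (Cmod z / 2 < Cmod w)%R).
  { assert (H := Cmod_triangle (z - w) w).
    replace (z - w + w) with z in H by ring.
    replace (z - w) with (- (w - z)) in H by ring; rewrite Cmod_opp in H; lra. }
  assert (Hw0 : w <> 0) by (apply Cmod_gt_0; lra).
  replace (/ w - / z - (w - z) * - / z ^ 2) with ((w - z) ^ 2 * / (w * z ^ 2))
    by (field; auto).
  rewrite Cmod_mult, Cmod_inv, Cmod_mult, !Cmod_pow
    by (apply Cmult_neq_0; [|apply Cpow_nz]; assumption).
  rewrite Rmult_comm; apply Rmult_le_compat_r; [apply pow2_ge_0|].
  replace (2 / Cmod z ^ 3)%R with (/ (Cmod z / 2 * Cmod z ^ 2))%R by (field; lra).
  apply Rinv_le_contravar; [|apply Rmult_le_compat_r; [apply pow2_ge_0|lra]].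
  apply Rmult_lt_0_compat; [lra|apply pow_lt; assumption].
Qed.

Lemma is_derive_C_comp (f g : C -> C) (z df dg : C) :
  is_derive_C f (g z) df -> is_derive_C g z dg ->
  is_derive_C (fun w => f (g w)) z (dg * df).
Proof.
  intros Hf Hg; apply is_derive_C_AbsRing in Hg.
  exact (is_derive_comp (K := C_AbsRing) (V := C_NormedModule) f g z df dg Hf Hg).
Qed.

Lemma open_disc_locally (c z : C) (r : R) :
  open_disc c r z ->
  @locally (AbsRing_UniformSpace C_AbsRing) z (open_disc c r).
Proof.
  unfold open_disc; intros Hz.
  assert (Hd : (0 < r - Cmod (z - c))%R) by lra.
  exists (mkposreal _ Hd); intros w Hw.
  change (Cmod (w - z) < r - Cmod (z - c))%R in Hw.
  replace (w - c) with ((w - z) + (z - c)) by ring.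
  pose proof (Cmod_triangle (w - z) (z - c)); lra.
Qed.

Lemma is_derive_C_ext_disc (c z : C) (r : R) (f g : C -> C) (l : C) :
  open_disc c r z -> (forall w, open_disc c r w -> f w = g w) ->
  is_derive_C f z l -> is_derive_C g z l.
Proof.
  intros Hz Hfg; apply is_derive_ext_loc.
  now apply (filter_imp (open_disc c r)); [|apply open_disc_locally].
Qed.

(** * Complex power series with coefficients bounded by 1 *)

Lemma is_series_Cmod_le (a : nat -> C) (b : nat -> R) (l : C) (L : R) :
  is_series (K := C_AbsRing) (V := C_NormedModule) a l -> is_series b L ->
  (forall n, (Cmod (a n) <= b n)%R) -> (Cmod l <= L)%R.
Proof.
  intros Ha Hb Hab.
  assert (Hn : filterlim (fun n => norm (sum_n a n)) eventually (locally (Cmod l))).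
  { eapply filterlim_comp; [exact Ha|]. exact (filterlim_norm (V := C_NormedModule) l). }
  refine (filterlim_le (F := eventually) _ _ (Finite (Cmod l)) (Finite L) _ Hn Hb).
  exists 0%nat; intros n _.
  eapply Rle_trans; [exact (norm_sum_n_m (V := C_NormedModule) a 0 n)|].
  now apply sum_n_m_le.
Qed.

(** A total function whose value is meaningful only for convergent series; [CSeries_correct] secures
    this by a summable real majorant. *)
Definition CSeries (a : nat -> C) : C :=
  iota (T := C_CompleteNormedModule)
    (fun l => is_series (K := C_AbsRing) (V := C_NormedModule) a l).

Lemma CSeries_correct (a : nat -> C) (b : nat -> R) :
  (forall n, (Cmod (a n) <= b n)%R) -> ex_series b ->
  is_series (K := C_AbsRing) (V := C_NormedModule) a (CSeries a).
Proof.
  intros Hab Hb.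
  destruct (ex_series_le (V := C_CompleteNormedModule) a b Hab Hb) as [l Hl].
  apply (iota_correct (V := C_CompleteNormedModule)
    (fun l => is_series (K := C_AbsRing) (V := C_NormedModule) a l)).
  exists l; split; [exact Hl|].
  intros l' Hl'; exact (filterlim_locally_unique _ _ _ Hl Hl').
Qed.

Definition CPSeries (c : nat -> C) (z : C) : C := CSeries (fun n => c n * z ^ n).

Lemma Cmod_CPSeries_term (c : nat -> C) (z : C) (n : nat) :
  (forall n, (Cmod (c n) <= 1)%R) -> 
  (Cmod (c n * z ^ n) <= Cmod z ^ n)%R.
Proof.
  intros Hc; rewrite Cmod_mult, Cmod_pow; rewrite <- (Rmult_1_l (Cmod z ^ n)) at 2.
  apply Rmult_le_compat_r; [apply pow_le, Cmod_ge_0|apply Hc].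
Qed.

Lemma CPSeries_correct (c : nat -> C) (z : C) :
  (forall n, (Cmod (c n) <= 1)%R) -> (Cmod z < 1)%R ->
  is_series (K := C_AbsRing) (V := C_NormedModule)
    (fun n => c n * z ^ n) (CPSeries c z).
Proof.
  intros Hc Hz; apply (CSeries_correct _ (fun n => (Cmod z ^ n)%R)).
  - now intros n; apply Cmod_CPSeries_term.
  - apply ex_series_geom; rewrite Rabs_pos_eq; [assumption|apply Cmod_ge_0].
Qed.

(** The tail is dominated by a geometric series of ratio 1/2 starting at exponent M + 1. The bound
    does not depend on z, which is the source of the uniformity in t. *)
Lemma CPSeries_tail (c : nat -> C) (z : C) (M : nat) :
  (forall n, (Cmod (c n) <= 1)%R) -> (Cmod z <= / 2)%R ->
  (Cmod (sum_n (fun n => (c n * z ^ n)%C) M - CPSeries c z) <= (/ 2) ^ M)%R.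
Proof.
  intros Hc Hz.
  assert (Hz1 : (Cmod z < 1)%R) by lra.
  assert (Hs := CPSeries_correct c z Hc Hz1).
  assert (Ht : is_series (K := C_AbsRing) (V := C_NormedModule)
    (fun k => c (S M + k)%nat * z ^ (S M + k))
    (CPSeries c z - sum_n (fun n => c n * z ^ n) M)).
  { apply (is_series_incr_n (V := C_NormedModule) (fun n => c n * z ^ n)); [lia|].
    simpl pred.
    change (is_series (K := C_AbsRing) (V := C_NormedModule) (fun n => c n * z ^ n)
      (CPSeries c z - sum_n (fun n => c n * z ^ n) M + sum_n (fun n => c n * z ^ n) M)).
    match goal with |- is_series _ ?l => replace l with (CPSeries c z) by ring end.
    exact Hs. }
  rewrite <- Cmod_opp.
  replace (- (sum_n (fun n => c n * z ^ n) M - CPSeries c z))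
    with (CPSeries c z - sum_n (fun n => c n * z ^ n) M) by ring.
  apply (is_series_Cmod_le _ (fun k => ((/ 2) ^ S M * (/ 2) ^ k)%R) _ _ Ht).
  - replace ((/ 2) ^ M)%R with ((/ 2) ^ S M * / (1 - / 2))%R by (simpl; field).
    apply (is_series_scal (V := R_NormedModule) ((/ 2) ^ S M)%R (fun k => ((/ 2) ^ k)%R)).
    apply is_series_geom; rewrite Rabs_pos_eq; lra.
  - intros k; eapply Rle_trans; [now apply Cmod_CPSeries_term|].
    rewrite <- pow_add; apply pow_incr; split; [apply Cmod_ge_0|assumption].
Qed.

(* The right-hand side is the same remainder for the real polynomial (x + d)^n,
   rescaled by (|h| / d)^2: both remainders obey the same recursion in n. *)
Lemma Cmod_pow_taylor (z h : C) (d : R) (n : nat) :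
  (0 < d)%R -> (Cmod h <= d)%R ->
  (Cmod ((z + h) ^ S n - z ^ S n - h * (INR (S n) * z ^ n)) <=
    Cmod h ^ 2 / d ^ 2 *
      ((Cmod z + d) ^ S n - Cmod z ^ S n - d * (INR (S n) * Cmod z ^ n)))%R.
Proof.
  intros Hd Hh; induction n as [|n IHn].
  - simpl INR; replace ((z + h) ^ 1 - z ^ 1 - h * (1 * z ^ 0)) with (RtoC 0)
      by (simpl; ring).
    rewrite Cmod_0; right; simpl; field; lra.
  - replace ((z + h) ^ S (S n) - z ^ S (S n) - h * (INR (S (S n)) * z ^ S n))
      with ((z + h) * ((z + h) ^ S n - z ^ S n - h * (INR (S n) * z ^ n))
              + INR (S n) * (h ^ 2 * z ^ n))
      by (rewrite (S_INR (S n)), RtoC_plus, !Cpow_S; ring).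
    replace (Cmod h ^ 2 / d ^ 2 * ((Cmod z + d) ^ S (S n) - Cmod z ^ S (S n)
               - d * (INR (S (S n)) * Cmod z ^ S n)))%R
      with ((Cmod z + d) * (Cmod h ^ 2 / d ^ 2 *
               ((Cmod z + d) ^ S n - Cmod z ^ S n - d * (INR (S n) * Cmod z ^ n)))
             + INR (S n) * (Cmod h ^ 2 * Cmod z ^ n))%R
      by (rewrite (S_INR (S n)), <- !tech_pow_Rmult; field; lra).
    eapply Rle_trans; [apply Cmod_triangle|]; apply Rplus_le_compat.
    + rewrite Cmod_mult; apply Rmult_le_compat; try apply Cmod_ge_0; [|assumption].
      eapply Rle_trans; [apply Cmod_triangle|]; lra.
    + rewrite !Cmod_mult, !Cmod_pow, Cmod_R, Rabs_pos_eq by apply pos_INR; lra.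
Qed.

(** Termwise differentiation: with |z| + d < 1 and h = w - z, the remainder of the nth term is at
    most |h|^2 / d^2 (|z| + d)^n by [Cmod_pow_taylor]. These bounds form a convergent geometric
    series, so the total remainder is quadratic in h. *)
Lemma is_derive_CPSeries (c : nat -> C) (z : C) :
  (forall n, (Cmod (c n) <= 1)%R) -> (Cmod z < 1)%R ->
  is_derive_C (CPSeries c) z (CSeries (fun n => c n * (INR n * z ^ pred n))).
Proof.
  intros Hc Hz; pose (d := ((1 - Cmod z) / 2)%R).
  pose proof (Cmod_ge_0 z) as Hz0.
  assert (Hd : (0 < d)%R) by (unfold d; lra).
  assert (Hzd : (Cmod z + d < 1)%R) by (unfold d; lra).
  assert (Hgeom : ex_series (fun n => (/ d * (Cmod z + d) ^ n)%R)).
  { apply (ex_series_scal (V := R_NormedModule) (/ d)%R (fun n => ((Cmod z + d) ^ n)%R)).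
    apply ex_series_geom; rewrite Rabs_pos_eq; lra. }
  assert (Hder : is_series (K := C_AbsRing) (V := C_NormedModule)
    (fun n => c n * (INR n * z ^ pred n)) (CSeries (fun n => c n * (INR n * z ^ pred n)))).
  { apply (CSeries_correct _ _) with (2 := Hgeom); intros n.
    rewrite !Cmod_mult, Cmod_R, Cmod_pow, Rabs_pos_eq by apply pos_INR.
    apply Rle_trans with (INR n * Cmod z ^ pred n)%R.
    { rewrite <- (Rmult_1_l (INR n * _)) at 2.
      apply Rmult_le_compat_r; [|apply Hc].
      apply Rmult_le_pos; [apply pos_INR|now apply pow_le]. }
    apply (Rmult_le_reg_l d); [assumption|].
    replace (d * (/ d * (Cmod z + d) ^ n))%R with ((Cmod z + d) ^ n)%R by (field; lra).
    destruct n as [|n]; [simpl; lra|]; simpl pred.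
    (* For h = d the right-hand side bounds a modulus and is therefore nonnegative, which yields d
       (n + 1) |z|^n <= (|z| + d)^(n + 1). *)
    assert (Hp := Cmod_pow_taylor z d d n Hd).
    rewrite Cmod_R, Rabs_pos_eq in Hp by lra; specialize (Hp (Rle_refl d)).
    match type of Hp with (?l <= _)%R => assert (Hl : (0 <= l)%R) by apply Cmod_ge_0 end.
    replace (d ^ 2 / d ^ 2)%R with 1%R in Hp by (field; lra).
    assert (0 <= Cmod z ^ S n)%R by now apply pow_le.
    lra. }
  destruct Hgeom as [G HG].
  apply (is_derive_C_quadratic_remainder _ _ _ d (/ d * G)); [assumption|].
  intros w Hw.
  assert (Hw1 : (Cmod w < 1)%R).
  { replace w with ((w - z) + z) by ring.
    pose proof (Cmod_triangle (w - z) z); lra. }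
  assert (Hsz := CPSeries_correct c z Hc Hz); assert (Hsw := CPSeries_correct c w Hc Hw1).
  (* The remainder of the sum is the sum of the termwise remainders. *)
  assert (Hs := is_series_minus _ _ _ _ (is_series_minus _ _ _ _ Hsw Hsz)
     (is_series_scal (w - z) _ _ Hder)).
  refine (is_series_Cmod_le _ (fun n => (/ d * Cmod (w - z) ^ 2 * (/ d * (Cmod z + d) ^ n))%R)
    _ _ Hs _ _).
  - replace (/ d * G * Cmod (w - z) ^ 2)%R with (/ d * Cmod (w - z) ^ 2 * G)%R by ring.
    apply (is_series_scal (V := R_NormedModule) (/ d * Cmod (w - z) ^ 2)%R _ _ HG).
  - intros n; change (Cmod (c n * w ^ n - c n * z ^ n
      - (w - z) * (c n * (INR n * z ^ pred n))) <=
      / d * Cmod (w - z) ^ 2 * (/ d * (Cmod z + d) ^ n))%R.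
    replace (c n * w ^ n - c n * z ^ n - (w - z) * (c n * (INR n * z ^ pred n)))
      with (c n * ((z + (w - z)) ^ n - z ^ n - (w - z) * (INR n * z ^ pred n)))
      by (replace (z + (w - z)) with w by ring; ring).
    rewrite Cmod_mult.
    match goal with |- (_ * ?x <= ?y)%R => apply Rle_trans with (1 * x)%R end.
    { apply Rmult_le_compat_r; [apply Cmod_ge_0|apply Hc]. }
    rewrite Rmult_1_l.
    replace (/ d * Cmod (w - z) ^ 2 * (/ d * (Cmod z + d) ^ n))%R
      with (Cmod (w - z) ^ 2 / d ^ 2 * (Cmod z + d) ^ n)%R by (field; lra).
    assert (0 <= Cmod (w - z) ^ 2 / d ^ 2)%R.
    { apply Rmult_le_pos; [apply pow2_ge_0|].
      left; apply Rinv_0_lt_compat, pow_lt; assumption. }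
    destruct n as [|n].
    + simpl INR; replace ((z + (w - z)) ^ 0 - z ^ 0 - (w - z) * (0 * z ^ pred 0))
        with (RtoC 0) by (simpl; ring).
      rewrite Cmod_0; simpl pow at 3; lra.
    + eapply Rle_trans; [apply (Cmod_pow_taylor z (w - z) d n); lra|].
      apply Rmult_le_compat_l; [assumption|]; simpl pred.
      assert (0 <= Cmod z ^ S n)%R by now apply pow_le.
      assert (0 <= d * (INR (S n) * Cmod z ^ n))%R; [|lra].
      apply Rmult_le_pos; [lra|].
      apply Rmult_le_pos; [apply pos_INR|now apply pow_le].
Qed.

(** * Joint holomorphy in two variables *)

(** The two uniform structures on C have different balls but the same neighbourhoods, and this
    passes to the product. *)
Lemma locally_prod_C (p : C * C) (P : C * C -> Prop) :
  @locally (prod_UniformSpace C_UniformSpace C_UniformSpace) p P <->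
  @locally (prod_UniformSpace (AbsRing_UniformSpace C_AbsRing)
              (AbsRing_UniformSpace C_AbsRing)) p P.
Proof.
  destruct p as [x y]; split; intros [eps H].
  - destruct (proj1 (locally_C x _) (locally_ball (T := C_UniformSpace) x eps)) as [d1 H1].
    destruct (proj1 (locally_C y _) (locally_ball (T := C_UniformSpace) y eps)) as [d2 H2].
    exists (mkposreal _ (Rmin_stable_in_posreal d1 d2)); intros [u v] [Hu Hv].
    apply H; split; [apply H1|apply H2];
      (eapply ball_le; [|eassumption]); [apply Rmin_l|apply Rmin_r].
  - destruct (proj2 (locally_C x _)
      (locally_ball (T := AbsRing_UniformSpace C_AbsRing) x eps)) as [d1 H1].
    destruct (proj2 (locally_C y _)
      (locally_ball (T := AbsRing_UniformSpace C_AbsRing) y eps)) as [d2 H2].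
    exists (mkposreal _ (Rmin_stable_in_posreal d1 d2)); intros [u v] [Hu Hv].
    apply H; split; [apply H1|apply H2];
      (eapply ball_le; [|eassumption]); [apply Rmin_l|apply Rmin_r].
Qed.

Notation C2_NormedModule :=
  (prod_NormedModule C_AbsRing (AbsRing_NormedModule C_AbsRing)
     (AbsRing_NormedModule C_AbsRing)).

(** Source, target and filter all carry the structure of [AbsRing_NormedModule C_AbsRing], the
    setting of the product rule; [holomorphic2_on_intro] leads back to the structures used in
    [holomorphic2_on]. *)
Definition ex_filterdiff_C2 (f : C * C -> C) (p : C * C) : Prop :=
  ex_filterdiff (K := C_AbsRing) (U := C2_NormedModule)
    (V := AbsRing_NormedModule C_AbsRing) f (@locally C2_NormedModule p).

Lemma holomorphic2_on_intro (U V : C -> Prop) (f : C -> C -> C) :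
  (forall x y, U x -> V y -> ex_filterdiff_C2 (fun p => f (fst p) (snd p)) (x, y)) ->
  holomorphic2_on U V f.
Proof.
  intros H x y Hx Hy; destruct (H x y Hx Hy) as [l [[Hp Hs Hn] Hd]].
  exists l; split; [split; assumption|].
  intros p Hlim eps; apply locally_prod_C.
  refine (Hd p _ eps).
  intros P HP; apply locally_prod_C, Hlim; exact HP.
Qed.

Lemma ex_filterdiff_C2_mult (f g : C * C -> C) (p : C * C) :
  ex_filterdiff_C2 f p -> ex_filterdiff_C2 g p ->
  ex_filterdiff_C2 (fun w => f w * g w) p.
Proof.
  intros [lf Hf] [lg Hg]; eexists.
  exact (filterdiff_mult_fct (U := C2_NormedModule) f g p lf lg Cmult_comm Hf Hg).
Qed.

Lemma ex_filterdiff_C2_comp (f : C * C -> C) (g : C -> C) (p : C * C) (l : C) :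
  ex_filterdiff_C2 f p -> is_derive_C g (f p) l ->
  ex_filterdiff_C2 (fun w => g (f w)) p.
Proof.
  intros [lf Hf] Hg; apply is_derive_C_AbsRing in Hg; eexists.
  exact (filterdiff_comp' (U := C2_NormedModule) (V := AbsRing_NormedModule C_AbsRing)
    (W := AbsRing_NormedModule C_AbsRing) f g p lf _ Hf Hg).
Qed.

Lemma ex_filterdiff_C2_fst (p : C * C) : ex_filterdiff_C2 fst p.
Proof.
  apply ex_filterdiff_linear.
  exact (is_linear_fst (U := AbsRing_NormedModule C_AbsRing)
           (V := AbsRing_NormedModule C_AbsRing)).
Qed.

Lemma ex_filterdiff_C2_snd (p : C * C) : ex_filterdiff_C2 snd p.
Proof.
  apply ex_filterdiff_linear.
  exact (is_linear_snd (U := AbsRing_NormedModule C_AbsRing)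
           (V := AbsRing_NormedModule C_AbsRing)).
Qed.

(** * Functions that differentiate like powers of t *)

(* [f] differentiates at [z] like a multiple of the power z^a. *)
Definition log_derive_C (f : C -> C) (z a : C) : Prop := is_derive_C f z (a * f z / z).

Lemma log_derive_C_mult (f g : C -> C) (z a b : C) :
  log_derive_C f z a -> log_derive_C g z b ->
  log_derive_C (fun w => f w * g w) z (a + b).
Proof.
  unfold log_derive_C; intros Hf Hg; generalize (is_derive_C_mult _ _ _ _ _ Hf Hg).
  match goal with |- is_derive _ _ ?l -> is_derive _ _ ?l' =>
    replace l with l'; [trivial|] end.
  unfold Cdiv; ring.
Qed.

Lemma log_derive_C_inv (f : C -> C) (z a : C) :
  f z <> 0 -> log_derive_C f z a -> log_derive_C (fun w => / f w) z (- a).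
Proof.
  unfold log_derive_C; intros H0 Hf.
  generalize (is_derive_C_comp _ _ _ _ _ (is_derive_C_inv _ H0) Hf).
  match goal with |- is_derive _ _ ?l -> is_derive _ _ ?l' =>
    replace l with l'; [trivial|] end.
  unfold Cdiv; generalize (/ z); intros y; field; assumption.
Qed.

Lemma log_derive_C_pow (f : C -> C) (z a : C) (n : nat) :
  log_derive_C f z a -> log_derive_C (fun w => f w ^ n) z (INR n * a).
Proof.
  intros Hf; induction n as [|n IHn].
  - unfold log_derive_C.
    generalize (is_derive_const (K := C_AbsRing) (V := C_NormedModule) (RtoC 1) z).
    change (@zero C_NormedModule) with (RtoC 0).
    simpl INR; replace (0 * a * f z ^ 0 / z) with (RtoC 0) by (unfold Cdiv; ring).
    trivial.
  - replace (INR (S n) * a) with (a + INR n * a) by (rewrite S_INR, RtoC_plus; ring).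
    exact (log_derive_C_mult _ _ _ _ _ Hf IHn).
Qed.

(* The power u^(1 - 5 m). *)
Definition monomial (u : C) (m : nat) : C := u * (/ u ^ 5) ^ m.

Lemma monomial_neq_0 (u : C) (m : nat) : u <> 0 -> monomial u m <> 0.
Proof.
  intros Hu; apply Cmult_neq_0; [assumption|].
  apply Cpow_nz; rewrite <- Cpow_inv by assumption.
  apply Cpow_nz; intros H; apply Hu.
  rewrite <- (Cmult_1_r u), <- (Cinv_l u Hu), H; ring.
Qed.

Lemma log_derive_C_monomial (f : C -> C) (z : C) (m : nat) :
  f z <> 0 -> log_derive_C f z (/ 2) ->
  log_derive_C (fun w => monomial (f w) m) z ((1 - 5 * INR m) / 2).
Proof.
  intros H0 Hf.
  replace ((1 - 5 * INR m) / 2) with (/ 2 + INR m * - (INR 5 * / 2)).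
  - apply (log_derive_C_mult f (fun w => (/ f w ^ 5) ^ m)); [assumption|].
    apply (log_derive_C_pow (fun w => / f w ^ 5)).
    apply (log_derive_C_inv (fun w => f w ^ 5)); [now apply Cpow_nz|].
    now apply log_derive_C_pow.
  - replace (INR 5) with 5%R by (simpl; ring); field.
Qed.

Lemma is_C_derive_ext_disc (c z : C) (r : R) (f g : C -> C) (l : C) :
  open_disc c r z -> (forall w, open_disc c r w -> f w = g w) ->
  is_derive_C g z l -> C_derive f z = l.
Proof.
  intros Hz Hfg Hg; apply is_C_derive_unique.
  apply (is_derive_C_ext_disc c z r g); [assumption| |assumption].
  intros w Hw; now rewrite Hfg.
Qed.

(** As for t^a, two derivatives bring out a (a - 1) / t^2. The hypotheses hold on a whole disc
    because the outer derivative needs the inner one on a neighbourhood of t. *)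
Lemma log_derive_C_second (t0 : C) (r : R) (f g : C -> C) (d a : C) :
  ~ open_disc t0 r 0 ->
  (forall t, open_disc t0 r t -> f t = d * g t) ->
  (forall t, open_disc t0 r t -> log_derive_C g t a) ->
  forall t, open_disc t0 r t ->
    C_derive (C_derive f) t = d * (a * (a - 1)) * g t / t ^ 2.
Proof.
  intros H0 Hfg Hg t Ht.
  assert (Hnz : forall w, open_disc t0 r w -> w <> 0) by (intros w Hw ->; auto).
  apply (is_C_derive_ext_disc t0 t r _ (fun w => d * (a * g w * / w))).
  - assumption.
  - intros w Hw.
    apply (is_C_derive_ext_disc t0 w r f (fun v => d * g v)); auto.
    now apply is_derive_C_scal, Hg.
  - replace (d * (a * (a - 1)) * g t / t ^ 2)
      with (d * (a * (a * g t / t) * / t + a * g t * - / t ^ 2))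
      by (field; auto).
    apply is_derive_C_scal, (is_derive_C_mult (fun w => a * g w) Cinv).
    + now apply is_derive_C_scal, Hg.
    + now apply is_derive_C_inv, Hnz.
Qed.

(** * The recursion for the constants d_n and its factorial bound *)

Lemma sum_n_Cmult_r (f : nat -> C) (c : C) (m : nat) :
  sum_n (fun k => f k * c) m = sum_n f m * c.
Proof.
  exact (sum_n_mult_r (K := C_Ring) c f m).
Qed.

(** In the convolution of order m + 2, the two end terms are those that contain the unknown
    coefficient q_(m+2). *)
Lemma sum_n_ends (f : nat -> C) (m : nat) :
  sum_n f (S (S m)) = f 0%nat + sum_n (fun k => f (S k)) m + f (S (S m)).
Proof.
  rewrite sum_Sn; unfold sum_n at 1.
  rewrite sum_Sn_m by lia; rewrite <- sum_n_m_S; reflexivity.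
Qed.

Lemma Cmod_sum_n_le (f : nat -> C) (m : nat) (B : R) :
  (forall k, (k <= m)%nat -> (Cmod (f k) <= B)%R) ->
  (Cmod (sum_n f m) <= INR (S m) * B)%R.
Proof.
  induction m as [|m IHm]; intros Hf.
  - rewrite sum_O; simpl INR; rewrite Rmult_1_l; auto.
  - rewrite sum_Sn, S_INR.
    eapply Rle_trans; [apply Cmod_triangle|].
    rewrite Rmult_plus_distr_r, Rmult_1_l; apply Rplus_le_compat; auto.
Qed.

Lemma fact_mult_le (a b : nat) : (fact a * fact b <= fact (a + b))%nat.
Proof.
  induction a as [|a IHa]; simpl fact; nia.
Qed.

(* The coefficient d_(m+2) in terms of the earlier ones; the fraction a (a - 1) / 36
   is what two derivatives of u^(1 - 5m/2) contribute, as t^2 = 36 u^4. *)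
Definition recursion_rhs (d : nat -> C) (m : nat) : C :=
  let a := (1 - 5 * INR (Nat.div2 m)) / 2 in
  / 12 * (d m * (a * (a - 1)) / 36
          - 6 * sum_n (fun k => d (S k) * d (S m - k)%nat) m).

(** Each half of (m + 1)! pays for one term. The m + 1 products are at most k! (m - k)! <= m! each,
    and their sum enters with factor 6/12 = 1/2. The linear term has factor a (a - 1) / 432 = (25
    p^2 - 1) / 1728 with p <= m / 2, and quadratic growth in m is absorbed in passing from (m - 1)!
    to (m + 1)!. *)
Lemma Cmod_recursion_rhs (d : nat -> C) (m : nat) :
  (forall k, (k <= S m)%nat -> (Cmod (d k) <= INR (fact (pred k)))%R) ->
  (Cmod (recursion_rhs d m) <= INR (fact (S m)))%R.
Proof.
  intros Hd; unfold recursion_rhs; cbv zeta.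
  assert (Hsum : (Cmod (sum_n (fun k => (d (S k) * d (S m - k)%nat)%C) m)
                    <= INR (fact (S m)))%R).
  { eapply Rle_trans; [apply (Cmod_sum_n_le _ m (INR (fact m)))|].
    - intros k Hk; rewrite Cmod_mult.
      apply Rle_trans with (INR (fact k) * INR (fact (m - k)))%R.
      + replace (S m - k)%nat with (S (m - k)) by lia.
        apply Rmult_le_compat; try apply Cmod_ge_0; apply (Hd (S _)); lia.
      + rewrite <- mult_INR; apply le_INR.
        replace m with (k + (m - k))%nat at 2 by lia; apply fact_mult_le.
    - rewrite <- mult_INR; apply le_INR; simpl fact; lia. }
  set (Sg := sum_n _ m) in *.
  set (p := INR (Nat.div2 m)).
  replace (/ 12 * (d m * ((1 - 5 * p) / 2 * ((1 - 5 * p) / 2 - 1)) / 36 - 6 * Sg))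
    with (d m * RtoC ((25 * p ^ 2 - 1) / 1728) + RtoC (- / 2) * Sg).
  2:{ unfold Rdiv, Rminus.
      rewrite RtoC_mult, RtoC_plus, !RtoC_opp, RtoC_mult, RtoC_pow,
        !RtoC_inv by lra; field. }
  assert (Hp : (0 <= p)%R) by apply pos_INR.
  assert (Hdm := Hd m ltac:(lia)).
  (* Any constant up to 864 = 1728 / 2 keeps the linear term within its half. *)
  assert (Hf : (INR (fact (pred m)) * (25 * p ^ 2 + 1) <= 800 * INR (fact (S m)))%R).
  { assert (Hpm : (2 * p <= INR m)%R).
    { unfold p; rewrite <- (mult_INR 2); apply le_INR.
      pose proof (Nat.div2_odd m); lia. }
    destruct m as [|m].
    - simpl in *; nra.
    - simpl pred; rewrite !fact_simpl, !mult_INR.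
      assert (H1 := lt_0_INR _ (lt_O_fact m)).
      assert (H2 : (1 <= INR (S m))%R) by (apply (le_INR 1); lia).
      rewrite (S_INR (S m)).
      apply Rle_trans with (INR (fact m) * (800 * (INR (S m) * INR (S m))))%R;
        [|nra].
      apply Rmult_le_compat_l; nra. }
  eapply Rle_trans; [apply Cmod_triangle|].
  rewrite !Cmod_mult, !Cmod_R.
  assert (Ha : (Rabs ((25 * p ^ 2 - 1) / 1728) <= (25 * p ^ 2 + 1) / 1728)%R).
  { pose proof (pow2_ge_0 p); apply Rabs_le; lra. }
  assert (Hb : (Rabs (- / 2) = / 2)%R) by (rewrite Rabs_Ropp, Rabs_pos_eq; lra).
  rewrite Hb.
  assert (Hc := Rmult_le_compat _ _ _ _ (Cmod_ge_0 (d m)) (Rabs_pos _) Hdm Ha).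
  pose proof (pos_INR (fact (S m))); lra.
Qed.

(** For even indices the exponents add: u^(1 - 5j/2) u^(1 - 5k/2) = u u^(1 - 5(j + k)/2). [Nat.div2]
    is not additive on two odd numbers, but when an index is odd both sides vanish. *)
Lemma coefficient_mult (u c1 c2 : C) (j k : nat) :
  (Nat.odd j = true -> c1 = 0) -> (Nat.odd k = true -> c2 = 0) ->
  c1 * monomial u (Nat.div2 j) * (c2 * monomial u (Nat.div2 k)) =
  c1 * c2 * (u * monomial u (Nat.div2 (j + k))).
Proof.
  intros Hj Hk.
  destruct (Nat.odd j) eqn:Ej; [rewrite Hj by reflexivity; ring|].
  destruct (Nat.odd k) eqn:Ek; [rewrite Hk by reflexivity; ring|].
  replace (Nat.div2 (j + k)) with (Nat.div2 j + Nat.div2 k)%nat.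
  - unfold monomial; rewrite Cpow_add_r; ring.
  - pose proof (Nat.div2_odd j) as Dj; pose proof (Nat.div2_odd k) as Dk.
    rewrite Ej in Dj; rewrite Ek in Dk; simpl Nat.b2n in Dj, Dk.
    rewrite Dj, Dk at 2.
    replace (2 * Nat.div2 j + 0 + (2 * Nat.div2 k + 0))%nat
      with (2 * (Nat.div2 j + Nat.div2 k))%nat by lia.
    now rewrite Nat.div2_double.
Qed.

(** * The shape of the formal solution *)

Lemma formal_solution_order_0 (t0 : C) (r : R) (q : nat -> C -> C) (t : C) :
  formal_solution_branch (open_disc t0 r) q -> open_disc t0 r t ->
  t = - 6 * q 0%nat t ^ 2.
Proof.
  intros [_ Hq] Ht; generalize (Hq 0%nat t Ht).
  unfold PI_lhs_coeff, PI_rhs_coeff; rewrite sum_O; simpl Nat.sub; intros H.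
  replace t with (6 * (q 0%nat t * q 0%nat t) + t - 6 * (q 0%nat t * q 0%nat t)) at 1 by ring.
  rewrite <- H; ring.
Qed.

Lemma formal_solution_order_0_neq_0 (t0 : C) (r : R) (q : nat -> C -> C) (t : C) :
  ~ open_disc t0 r 0 ->
  formal_solution_branch (open_disc t0 r) q -> open_disc t0 r t -> q 0%nat t <> 0.
Proof.
  intros H0 Hq Ht Hz; apply H0.
  assert (H := formal_solution_order_0 t0 r q t Hq Ht).
  replace (RtoC 0) with t; [assumption|].
  rewrite H, Hz; ring.
Qed.

(** Differentiating t = -6 u^2 gives 1 = -12 u u', hence u' = -1 / (12 u) = u / (2 t). *)
Lemma log_derive_C_order_0 (t0 : C) (r : R) (q : nat -> C -> C) (t : C) :
  ~ open_disc t0 r 0 ->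
  formal_solution_branch (open_disc t0 r) q -> open_disc t0 r t ->
  log_derive_C (q 0%nat) t (/ 2).
Proof.
  intros H0 Hq Ht.
  assert (Hu := formal_solution_order_0_neq_0 t0 r q t H0 Hq Ht).
  destruct (proj1 Hq 0%nat t Ht : exists l : C, is_derive_C (q 0%nat) t l) as [l Hl].
  assert (H1 : is_derive_C (fun w => - 6 * (q 0%nat w * q 0%nat w)) t
            (- 6 * (l * q 0%nat t + q 0%nat t * l)))
    by now apply is_derive_C_scal, is_derive_C_mult.
  apply (is_derive_C_ext_disc t0 t r _ (fun w => w)) in H1; [|assumption|].
  2:{ intros w Hw; rewrite (formal_solution_order_0 t0 r q w Hq Hw) at 3; ring. }
  assert (H2 := is_C_derive_unique _ _ _ H1).
  assert (H3 := is_C_derive_unique _ _ _ (is_derive_C_id t)).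
  assert (H4 : RtoC 1 = - 6 * (l * q 0%nat t + q 0%nat t * l))
    by exact (eq_trans (eq_sym H3) H2).
  unfold log_derive_C; replace (/ 2 * q 0%nat t / t) with l; [assumption|].
  rewrite (formal_solution_order_0 t0 r q t Hq Ht) at 2.
  rewrite <- (Cmult_1_r (_ / _)), H4; field; assumption.
Qed.

(** Strong induction: for n >= 1 the equation of order n is linear in q_n with the nonzero factor 12
    q_0, and its other terms are constant multiples of u u^(1 - 5n/2). Since [pred 0] is 0, the
    bound at n = 0 reads |d_0| <= 1. *)
Lemma formal_solution_coefficients (t0 : C) (r : R) (q : nat -> C -> C) :
  (0 < r)%R -> ~ open_disc t0 r 0 -> formal_solution_branch (open_disc t0 r) q ->
  exists d : nat -> C, forall n,
    (Nat.odd n = true -> d n = 0) /\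
    (Cmod (d n) <= INR (fact (pred n)))%R /\
    (forall t, open_disc t0 r t -> q n t = d n * monomial (q 0%nat t) (Nat.div2 n)).
Proof.
  intros Hr H0 Hq.
  assert (Ht0 : open_disc t0 r t0).
  { unfold open_disc; replace (t0 - t0) with (RtoC 0) by ring; now rewrite Cmod_0. }
  assert (Hu := fun t Ht => formal_solution_order_0_neq_0 t0 r q t H0 Hq Ht).
  (* Evaluation at the centre t_0 defines all constants before the induction; [Hd] then identifies
     each with the value found from the equation. *)
  pose (d := fun n => q n t0 / monomial (q 0%nat t0) (Nat.div2 n)).
  assert (Hd : forall n E,
    (forall t, open_disc t0 r t -> q n t = E * monomial (q 0%nat t) (Nat.div2 n)) -> d n = E).
  { intros n E HE; unfold d; rewrite (HE t0 Ht0); field.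
    now apply monomial_neq_0, Hu. }
  exists d; intros n; induction n as [n IH] using (well_founded_induction lt_wf).
  destruct n as [|[|m]].
  - assert (H : forall t, open_disc t0 r t -> q 0%nat t = 1 * monomial (q 0%nat t) (Nat.div2 0)).
    { intros t _; unfold monomial; simpl; ring. }
    rewrite (Hd 0%nat 1 H); repeat split; [discriminate| |assumption].
    rewrite Cmod_1; simpl; lra.
  - assert (H : forall t, open_disc t0 r t -> q 1%nat t = 0 * monomial (q 0%nat t) (Nat.div2 1)).
    (* Order one reads 12 q_0 q_1 = 0. *)
    { intros t Ht; generalize (proj2 Hq 1%nat t Ht).
      unfold PI_lhs_coeff, PI_rhs_coeff; rewrite sum_Sn, sum_O; simpl Nat.sub.
      change plus with Cplus; intros H.
      replace (q 1%nat t) with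
        ((6 * (q 0%nat t * q 1%nat t + q 1%nat t * q 0%nat t) + 0) / (12 * q 0%nat t))
        by (field; auto).
      rewrite <- H; unfold Cdiv; rewrite !Cmult_0_l; reflexivity. }
    rewrite (Hd 1%nat 0 H); repeat split; [|assumption].
    rewrite Cmod_0; simpl; lra.
  - assert (H : forall t, open_disc t0 r t ->
      q (S (S m)) t = recursion_rhs d m * monomial (q 0%nat t) (Nat.div2 (S (S m)))).
    { intros t Ht; generalize (proj2 Hq (S (S m)) t Ht).
      unfold PI_lhs_coeff, PI_rhs_coeff.
      destruct (IH m ltac:(lia)) as [_ [_ Hm]].
      assert (Hlog : forall w, open_disc t0 r w -> log_derive_C
        (fun w => monomial (q 0%nat w) (Nat.div2 m)) w ((1 - 5 * INR (Nat.div2 m)) / 2)).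
      { intros w Hw; apply log_derive_C_monomial;
          [now apply Hu|now apply (log_derive_C_order_0 t0 r)]. }
      rewrite (log_derive_C_second t0 r (q m) _ _ _ H0 Hm Hlog t Ht).
      rewrite sum_n_ends.
      replace (S (S m) - S (S m))%nat with 0%nat by lia.
      rewrite Nat.sub_0_r.
      rewrite (sum_n_ext_loc _ (fun k => (d (S k) * d (S m - k)%nat) *
        (q 0%nat t * monomial (q 0%nat t) (Nat.div2 (S (S m)))))).
      2:{ intros k Hk; change (S (S m) - S k)%nat with (S m - k)%nat.
          destruct (IH (S k) ltac:(lia)) as [Ok [_ Hk']].
          destruct (IH (S m - k)%nat ltac:(lia)) as [Ol [_ Hl']].
          rewrite Hk', Hl' by assumption.
          replace (S (S m)) with (S k + (S m - k))%nat by lia.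
          now apply coefficient_mult. }
      rewrite sum_n_Cmult_r.
      unfold recursion_rhs; cbv zeta.
      set (Sg := sum_n _ m).
      set (a := (1 - 5 * INR (Nat.div2 m)) / 2).
      specialize (Hu t Ht).
      assert (Ht' := formal_solution_order_0 t0 r q t Hq Ht).
      set (u := q 0%nat t) in *.
      (* Raising the index by two costs a factor u^5; division by t^2 = 36 u^4 leaves the same
         factor u as in the quadratic terms. *)
      assert (Hmon : monomial u (Nat.div2 m) = u ^ 5 * monomial u (Nat.div2 (S (S m)))).
      { unfold monomial; change (Nat.div2 (S (S m))) with (S (Nat.div2 m)).
        rewrite (Cpow_S (/ u ^ 5)); generalize ((/ u ^ 5) ^ Nat.div2 m).
        intros y; field; auto. }
      assert (Ht2 : t ^ 2 = 36 * u ^ 4) by (rewrite Ht'; ring).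
      rewrite Hmon, Ht2; set (w := monomial u _); intros H.
      replace (q (S (S m)) t) with
        ((6 * (u * q (S (S m)) t + Sg * (u * w) + q (S (S m)) t * u) + 0
          - 6 * (Sg * (u * w))) / (12 * u)) by (field; assumption).
      rewrite <- H; field; auto. }
    rewrite (Hd _ _ H); repeat split; [|apply Cmod_recursion_rhs|assumption].
    (* The indices [S k] and [S m - k] have the odd sum [S (S m)], so one of them is odd and its
       constant vanishes. *)
    + intros Hodd; unfold recursion_rhs; cbv zeta.
      rewrite (proj1 (IH m ltac:(lia)) Hodd).
      rewrite (sum_n_ext_loc _ (fun k => d (S k) * 0)).
      * rewrite sum_n_Cmult_r; field.
      * intros k Hk.
        destruct (Nat.odd (S k)) eqn:Ek.
        -- rewrite (proj1 (IH (S k) ltac:(lia)) Ek), !Cmult_0_l; reflexivity.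
        -- rewrite (proj1 (IH (S m - k)%nat ltac:(lia))); [reflexivity|].
           replace (S (S m)) with (S k + (S m - k))%nat in Hodd by lia.
           rewrite Nat.odd_add, Ek in Hodd; destruct (Nat.odd (S m - k)); auto.
    + intros k Hk; now apply (IH k ltac:(lia)).
Qed.

(** * The Borel transform near t_0 *)

Lemma ex_filterdiff_C2_pow (f : C * C -> C) (p : C * C) (n : nat) :
  ex_filterdiff_C2 f p -> ex_filterdiff_C2 (fun w => f w ^ n) p.
Proof.
  intros Hf; induction n as [|n IHn].
  - exact (ex_filterdiff_C2_comp _ _ _ _ Hf (is_derive_const (RtoC 1) _)).
  - exact (ex_filterdiff_C2_mult _ _ _ Hf IHn).
Qed.

(** The term of index n involves q_(n+1), so only odd n = 2m + 1 survive, with u^(1 - 5(m + 1)) =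
    u^(-4) u^(-5m). The vanishing term 2M + 2 makes two consecutive partial sums agree, which covers
    every N >= 1. *)
Lemma borel_partial_sum_coefficients (q : nat -> C -> C) (d : nat -> C) (t xi : C) (M : nat) :
  (forall n, Nat.odd n = true -> d n = 0) ->
  (forall n, q n t = d n * monomial (q 0%nat t) (Nat.div2 n)) ->
  let P := monomial (q 0%nat t) 1 * xi *
    sum_n (fun m => d (2 * S m)%nat / INR (fact (S (2 * m))) *
                      (/ q 0%nat t ^ 5 * xi ^ 2) ^ m) M in
  borel_partial_sum q (S (2 * M)) t xi = P /\
  borel_partial_sum q (S (S (2 * M))) t xi = P.
Proof.
  intros Hodd Hq; cbv zeta; unfold borel_partial_sum.
  set (f := fun n => q (S n) t / INR (fact n) * xi ^ n).
  set (g := fun m => d (2 * S m)%nat / INR (fact (S (2 * m))) *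
                       (/ q 0%nat t ^ 5 * xi ^ 2) ^ m).
  assert (Heven : forall m, f (2 * m)%nat = 0).
  { intros m; unfold f; rewrite Hq, Hodd; [unfold Cdiv; ring|].
    now rewrite Nat.odd_succ, Nat.even_mul. }
  assert (Hterm : forall m, f (S (2 * m)) = monomial (q 0%nat t) 1 * xi * g m).
  { intros m; unfold f, g; rewrite Hq.
    replace (S (S (2 * m))) with (2 * S m)%nat by lia.
    rewrite Nat.div2_double; unfold monomial.
    rewrite Cpow_S, Cpow_1_r, (Cpow_S xi), Cpow_mult_r, Cpow_mult_l.
    unfold Cdiv; ring. }
  assert (H : sum_n f (S (2 * M)) = monomial (q 0%nat t) 1 * xi * sum_n g M).
  { induction M as [|M IHM].
    - rewrite sum_Sn, !sum_O, <- Hterm.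
      change (f (2 * 0)%nat + f (S (2 * 0)) = f (S (2 * 0))); rewrite Heven.
      apply Cplus_0_l.
    - replace (2 * S M)%nat with (S (S (2 * M))) by lia.
      rewrite (sum_Sn f), (sum_Sn f), (sum_Sn g), IHM.
      replace (S (S (2 * M))) with (2 * S M)%nat by lia.
      rewrite Heven, Hterm, Cmult_plus_distr_l.
      exact (f_equal (fun v => v + _) (Cplus_0_r _)). }
  split; [exact H|].
  rewrite sum_Sn, H; replace (S (S (2 * M))) with (2 * S M)%nat by lia.
  rewrite Heven; apply Cplus_0_r.
Qed.

(** On the disc |t| lies between |t_0| / 2 and 3 |t_0| / 2, and |q_0|^2 = |t| / 6; the upper bound
    is crude but needs no root. *)
Lemma order_0_bounds (t0 : C) (q : nat -> C -> C) (t : C) :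
  t0 <> 0 -> formal_solution_branch (open_disc t0 (Cmod t0 / 2)) q ->
  open_disc t0 (Cmod t0 / 2) t ->
  (sqrt (Cmod t0 / 12) <= Cmod (q 0%nat t) <= 1 + Cmod t0)%R.
Proof.
  intros Ht0 Hq Ht; assert (HT := proj1 (Cmod_gt_0 t0) Ht0).
  assert (H6 : Cmod t = (6 * Cmod (q 0%nat t) ^ 2)%R).
  { rewrite (formal_solution_order_0 _ _ q t Hq Ht) at 1.
    rewrite Cmod_mult, Cmod_pow, Cmod_R, Rabs_left by lra; lra. }
  unfold open_disc in Ht.
  assert (H1 := Cmod_triangle (t0 - t) t); replace (t0 - t + t) with t0 in H1 by ring.
  assert (H2 := Cmod_triangle (t - t0) t0); replace (t - t0 + t0) with t in H2 by ring.
  replace (t0 - t) with (- (t - t0)) in H1 by ring; rewrite Cmod_opp in H1.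
  pose proof (Cmod_ge_0 (q 0%nat t)) as Hq0.
  split; [|nra].
  rewrite <- (sqrt_pow2 (Cmod (q 0%nat t))) by assumption.
  apply sqrt_le_1_alt; lra.
Qed.

Theorem proposition2p2 :
  forall t0 : C, t0 <> RtoC 0 ->
  exists r rho : R,
    (0 < r)%R /\ (0 < rho)%R /\ ~ open_disc t0 r (RtoC 0) /\
    forall q : nat -> C -> C, formal_solution_branch (open_disc t0 r) q ->
    exists omega : C -> C -> C,
      (forall xi : C, open_disc (RtoC 0) rho xi ->
         converges_uniformly_on (open_disc t0 r)
           (fun (N : nat) (t : C) => borel_partial_sum q N t xi)
           (fun t : C => omega t xi)) /\
      holomorphic2_on (open_disc t0 r) (open_disc (RtoC 0) rho) omega.
Proof.
  intros t0 Ht0; assert (HT := proj1 (Cmod_gt_0 t0) Ht0).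
  assert (Hl : (0 < sqrt (Cmod t0 / 12))%R) by (apply sqrt_lt_R0; lra).
  set (l := sqrt (Cmod t0 / 12)) in Hl.
  (* As [l] bounds |q_0| from below, [s] bounds |q_0^(-5)| from above. Both depend on t_0 alone, so
     the radii serve all branches. *)
  pose (s := (/ l ^ 5)%R).
  assert (Hs : (0 < s)%R) by now apply Rinv_0_lt_compat, pow_lt.
  (* This radius for xi gives |u^(-5) xi^2| <= s / (2 + s)^2 <= 1/2. *)
  assert (Hrho : (0 < / (2 + s))%R) by (apply Rinv_0_lt_compat; lra).
  assert (H0 : ~ open_disc t0 (Cmod t0 / 2) 0).
  { unfold open_disc; replace (0 - t0) with (- t0) by ring; rewrite Cmod_opp; lra. }
  exists (Cmod t0 / 2)%R, (/ (2 + s))%R; repeat split; [lra|assumption|assumption|].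
  intros q Hq.
  destruct (formal_solution_coefficients t0 (Cmod t0 / 2) q) as [d Hd];
    [lra|assumption|assumption|].
  pose (c := fun m => d (2 * S m)%nat / INR (fact (S (2 * m)))).
  assert (Hc : forall m, (Cmod (c m) <= 1)%R).
  { intros m; unfold c.
    assert (Hf := lt_0_INR _ (lt_O_fact (S (2 * m)))).
    rewrite Cmod_div, Cmod_R, Rabs_pos_eq by
      (lra || (intros H; apply RtoC_inj in H; lra)).
    apply (Rmult_le_reg_r (INR (fact (S (2 * m))))); [assumption|].
    unfold Rdiv; rewrite Rmult_assoc, Rinv_l, Rmult_1_r, Rmult_1_l by lra.
    replace (S (2 * m)) with (pred (2 * S m)) by lia.
    apply Hd. }
  assert (Hq0 : forall t, open_disc t0 (Cmod t0 / 2) t -> q 0%nat t <> 0)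
    by (intros t; now apply formal_solution_order_0_neq_0).
  assert (Hinv : forall t, open_disc t0 (Cmod t0 / 2) t -> (Cmod (/ q 0%nat t ^ 5) <= s)%R).
  { intros t Ht; rewrite Cmod_inv, Cmod_pow by now apply Cpow_nz, Hq0.
    apply Rinv_le_contravar; [now apply pow_lt|].
    apply pow_incr; split; [lra|now apply order_0_bounds]. }
  assert (Hz : forall t xi, open_disc t0 (Cmod t0 / 2) t -> open_disc 0 (/ (2 + s)) xi ->
    (Cmod (/ q 0%nat t ^ 5 * xi ^ 2) <= / 2)%R).
  { unfold open_disc at 2; intros t xi Ht Hxi.
    replace (xi - 0) with xi in Hxi by ring.
    rewrite Cmod_mult, Cmod_pow.
    apply Rle_trans with (s * (/ (2 + s)) ^ 2)%R.
    - apply Rmult_le_compat; [apply Cmod_ge_0|apply pow2_ge_0|now apply Hinv|].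
      apply pow_incr; split; [apply Cmod_ge_0|lra].
    - apply (Rmult_le_reg_r ((2 + s) ^ 2)); [apply pow_lt; lra|].
      replace (s * (/ (2 + s)) ^ 2 * (2 + s) ^ 2)%R with s by (field; lra).
      nra. }
  exists (fun t xi => monomial (q 0%nat t) 1 * xi * CPSeries c (/ q 0%nat t ^ 5 * xi ^ 2)).
  split.
  - intros xi Hxi eps Heps.
    (* [K] bounds the prefactor u^(-4) xi = u u^(-5) xi, one factor for each of u, u^(-5) and xi. *)
    pose (K := ((1 + Cmod t0) * s * / (2 + s))%R).
    assert (HK : (0 < K)%R) by (unfold K; repeat apply Rmult_lt_0_compat; lra).
    destruct (pow_lt_1_zero (/ 2) ltac:(rewrite Rabs_pos_eq; lra) (eps / K)) as [M0 HM0];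
      [now apply Rdiv_lt_0_compat|].
    exists (S (2 * M0)); intros N HN t Ht.
    (* Every N >= 2 M0 + 1 is 2M + 1 or 2M + 2 with M = [Nat.div2 (pred N)] >= M0. *)
    assert (HNM : exists M, (M0 <= M)%nat /\ (N = S (2 * M) \/ N = S (S (2 * M)))).
    { exists (Nat.div2 (pred N)); pose proof (Nat.div2_odd (pred N)) as HD.
      destruct (Nat.odd (pred N)); simpl Nat.b2n in HD; lia. }
    destruct HNM as [M [HM HNM]].
    destruct (borel_partial_sum_coefficients q d t xi M) as [B1 B2];
      [apply Hd|intros n; now apply Hd|].
    assert (B : borel_partial_sum q N t xi = monomial (q 0%nat t) 1 * xi *
      sum_n (fun m => c m * (/ q 0%nat t ^ 5 * xi ^ 2) ^ m) M)
      by (destruct HNM; subst N; assumption).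
    rewrite B; set (z := / q 0%nat t ^ 5 * xi ^ 2).
    match goal with |- (Cmod (?p * ?x - ?p * ?y) < _)%R =>
      replace (p * x - p * y) with (p * (x - y)) by ring end.
    rewrite Cmod_mult.
    apply Rle_lt_trans with (K * (/ 2) ^ M)%R.
    + apply Rmult_le_compat; try apply Cmod_ge_0.
      * unfold monomial; rewrite Cpow_1_r, !Cmod_mult; unfold K.
        apply Rmult_le_compat; [|apply Cmod_ge_0| |].
        -- apply Rmult_le_pos; apply Cmod_ge_0.
        -- apply Rmult_le_compat; try apply Cmod_ge_0;
             [now apply order_0_bounds|now apply Hinv].
        -- unfold open_disc in Hxi; replace (xi - 0) with xi in Hxi by ring; lra.
      * apply CPSeries_tail; [assumption|now apply Hz].
    + specialize (HM0 M HM); rewrite Rabs_pos_eq in HM0 by (apply pow_le; lra).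
      apply (Rmult_lt_compat_l K) in HM0; [|assumption].
      now replace (K * (eps / K))%R with eps in HM0 by (field; lra).
  - apply holomorphic2_on_intro; intros t xi Ht Hxi.
    destruct (proj1 Hq 0%nat t Ht : exists l : C, is_derive_C (q 0%nat) t l) as [l' Hl'].
    assert (F0 : ex_filterdiff_C2 (fun p => q 0%nat (fst p)) (t, xi))
      by exact (ex_filterdiff_C2_comp fst (q 0%nat) (t, xi) l' (ex_filterdiff_C2_fst _) Hl').
    assert (Hs5 : ex_filterdiff_C2 (fun p => / q 0%nat (fst p) ^ 5) (t, xi)).
    { refine (ex_filterdiff_C2_comp _ Cinv _ _
        (ex_filterdiff_C2_pow _ _ 5 F0) (is_derive_C_inv _ _)).
      now apply Cpow_nz, Hq0. }
    assert (Fxi := ex_filterdiff_C2_snd (t, xi)).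
    apply ex_filterdiff_C2_mult; [apply ex_filterdiff_C2_mult; [|assumption]|].
    + apply ex_filterdiff_C2_mult, ex_filterdiff_C2_pow; assumption.
    (* The inner argument has modulus at most 1/2 by [Hz], inside the unit disc where [CPSeries c]
       is differentiable. *)
    + refine (ex_filterdiff_C2_comp _ (CPSeries c) _ _ _ (is_derive_CPSeries c _ Hc _)).
      * apply ex_filterdiff_C2_mult, ex_filterdiff_C2_pow; assumption.
      * apply Rle_lt_trans with (/ 2)%R; [now apply Hz|lra].
Qed.
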